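(* Consider the bilinear system $\mathbf{x}(t+1)=\mathbf{A}\mathbf{x}(t)+\mathbf{B}\mathbf{u}(t)+\mathbf{N}(\mathbf{x}(t)\otimes\mathbf{u}(t))$ with $\mathbf{x}(t)\in\mathbb{R}^n$, $\mathbf{u}(t)\in\mathbb{R}^m$, $\mathbf{A}\in\mathbb{R}^{n\times n}$, $\mathbf{B}\in\mathbb{R}^{n\times m}$, $\mathbf{N}\in\mathbb{R}^{n\times mn}$, and assume the pair $(\mathbf{A},[\mathbf{B}\ \mathbf{N}])$ is controllable. Let $L\ge T\ge1$ be integers, let $\mathbf{Q}\in\mathbb{R}^{n\times n}$ and $\mathbf{R}\in\mathbb{R}^{m\times m}$ be positive semi-definite, and let $\mathbf{x_0},\mathbf{x_f}\in\mathbb{R}^n$. Let $\mathbf{x}(0),\dots,\mathbf{x}(L)$ be a state sequence generated by the system with input sequence $\mathbf{u}(0),\dots,\mathbf{u}(L-1)$, and assume these data are $T$-persistently exciting (i.e. $\mathcal{G}_T(L)$, defined in the context, has full row rank). Then the optimal control problem (P1) minimize $\sum_{t=0}^{T-1}\hat{\mathbf{x}}(t)^\top\mathbf{Q}\hat{\mathbf{x}}(t)+\hat{\mathbf{u}}(t)^\top\mathbf{R}\hat{\mathbf{u}}(t)$ over $\hat{\mathbf{u}}_{[0,T-1]}\in\mathbb{R}^{mT}$, subject to $\hat{\mathbf{x}}(t+1)=\mathbf{A}\hat{\mathbf{x}}(t)+\mathbf{B}\hat{\mathbf{u}}(t)+\mathbf{N}(\hat{\mathbf{x}}(t)\otimes\hat{\mathbf{u}}(t))$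 for $t=0,\dots,T-1$, $\hat{\mathbf{x}}(0)=\mathbf{x_0}$, $\hat{\mathbf{x}}(T)=\mathbf{x_f}$, is equivalent to the data-based problem (P2) minimize $\sum_{t=0}^{T-1}\bar{\mathbf{x}}(t)^\top\mathbf{Q}\bar{\mathbf{x}}(t)+\bar{\mathbf{u}}(t)^\top\mathbf{R}\bar{\mathbf{u}}(t)$ over $\alpha\in\mathbb{R}^{L-T+1}$, subject to $$\begin{bmatrix}\bar{\mathbf{x}}_{[0,T]}\\ \bar{\mathbf{u}}_{[0,T-1]}\end{bmatrix}=\begin{bmatrix}\mathcal{H}_{T+1}(\mathbf{x}_{[0,L]})\\ \mathcal{H}_T(\mathbf{u}_{[0,L-1]})\end{bmatrix}\alpha,\quad \bar{\mathbf{x}}(0)=\mathbf{x_0},\quad \bar{\mathbf{x}}(T)=\mathbf{x_f},\quad \bar{\mathbf{x}}\otimes\bar{\mathbf{u}}_{[0,T-1]}=\mathcal{H}_T(\mathbf{x}\otimes\mathbf{u}_{[0,L-1]})\alpha,$$ in the following sense: for every $\alpha$ feasible for (P2), the input $\bar{\mathbf{u}}_{[0,T-1]}=\mathcal{H}_T(\mathbf{u}_{[0,L-1]})\alpha$ is feasible for (P1), with corresponding state trajectory $\bar{\mathbf{x}}_{[0,T]}=\mathcal{H}_{T+1}(\mathbf{x}_{[0,L]})\alpha$ and the same cost; and every input feasible for (P1), with its state trajectory, is obtained in this way from some $\alpha$ feasible for (P2). Consequently the two problems have the same optimal value, and $\alpha$ is a minimizer of (P2) if and only if it is feasible for (P2)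 and $\mathcal{H}_T(\mathbf{u}_{[0,L-1]})\alpha$ is a minimizer of (P1).
   Context: For a sequence $f(0),f(1),\dots$ of vectors in $\mathbb{R}^d$ and $i\le j$, $f_{[i,j]}=[f(i)^\top\ \cdots\ f(j)^\top]^\top$ is the stacked vector; $\mathbf{x}\otimes\mathbf{u}_{[i,j]}$ is the stacked vector of $\mathbf{x}(i)\otimes\mathbf{u}(i),\dots,\mathbf{x}(j)\otimes\mathbf{u}(j)$, with $\otimes$ the Kronecker product (similarly for $\bar{\mathbf{x}}\otimes\bar{\mathbf{u}}_{[i,j]}$). For $1\le k\le j-i+1$, the (block) Hankel matrix of depth $k$, $\mathcal{H}_k(f_{[i,j]})\in\mathbb{R}^{dk\times(j-i-k+2)}$, is the matrix whose $c$-th column is $f_{[i+c-1,\,i+c+k-2]}$, $c=1,\dots,j-i-k+2$. The data are called $T$-persistently exciting if $$\mathcal{G}_T(L):=\begin{bmatrix}\mathcal{H}_1(\mathbf{x}_{[0,L-T]})\\ \mathcal{H}_T(\mathbf{u}_{[0,L-1]})\\ \mathcal{H}_T(\mathbf{x}\otimes\mathbf{u}_{[0,L-1]})\end{bmatrix}\in\mathbb{R}^{(n+mT+mnT)\times(L-T+1)}$$ has full row rank. *)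

(* Defs.v *)
From mathcomp Require Import all_boot all_order all_algebra.
From mathcomp Require Import classical_sets reals constructive_ereal ereal.
From mathcomp Require Export mxtens.

Set Implicit Arguments.
Unset Strict Implicit.
Unset Printing Implicit Defensive.

Import Order.TTheory GRing.Theory Num.Theory.
Local Open Scope classical_set_scope.
Local Open Scope ring_scope.

Section Sequences.
Context {K : realType} {d : nat}.

(* Finite sequences f(i), ..., f(j) are given by a total f : nat -> 'cV_d of
   which only the terms in range are used; [stack f i k] is the stacked vector
   f_[i, i + k - 1], with k blocks of size d. *)
Definition stack (f : nat -> 'cV[K]_d) (i k : nat) : 'cV[K]_(\sum_(s < k) d) :=
  \mxcol_(s < k) f (i + s)%N.

(* [block X t] is the t-th block of a stacked vector; the value 0 for k <= t is
   a dummy. *)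
Definition block (k : nat) (X : 'cV[K]_(\sum_(s < k) d)) (t : nat) : 'cV[K]_d :=
  if insub t is Some s then submxcol X s else 0.

(* Hankel matrix of depth k with q columns, built from f(i), ..., f(i+k+q-2).
   The Hankel matrix H_k(f_[i,j]) is [hankel f i k q] with q = j - i - k + 2;
   q is a parameter so that matrices of different depths with the same number
   of columns can be stacked without casts. *)
Definition hankel (f : nat -> 'cV[K]_d) (i k q : nat) :
    'M[K]_(\sum_(s < k) d, q) :=
  \matrix_(r, c) stack f (i + c)%N k r 0.

Lemma blockK (f : nat -> 'cV[K]_d) (i k t : nat) :
  (t < k)%N -> block (stack f i k) t = f (i + t)%N.
Proof. by move=> tk; rewrite /block insubT mxcolK. Qed.

End Sequences.

Section Systems.
Context {K : realType}.

(* The state sequence of x(t+1) = step (x t) (u t) from x(0) = x0. *)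
Fixpoint state_seq (X U : Type) (step : X -> U -> X) (x0 : X) (u : nat -> U)
    (t : nat) : X :=
  if t is s.+1 then step (state_seq step x0 u s) (u s) else x0.

Lemma state_seqP (X U : Type) (step : X -> U -> X) (x0 : X) (u : nat -> U)
    (k : nat) (x : nat -> X) :
  (x 0 = x0 /\ forall t, (t < k)%N -> x t.+1 = step (x t) (u t)) <->
  (forall t, (t <= k)%N -> x t = state_seq step x0 u t).
Proof.
split=> [[x_0 xS] t|xE].
  by elim: t => //= t IHt tk; rewrite xS // IHt // ltnW.
by split=> [|t tk]; rewrite !xE // ltnW.
Qed.

Definition linear_step (n p : nat) (A : 'M[K]_n) (B : 'M[K]_(n, p))
    (x : 'cV[K]_n) (v : 'cV[K]_p) : 'cV[K]_n :=
  A *m x + B *m v.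

Definition controllable (n p : nat) (A : 'M[K]_n) (B : 'M[K]_(n, p)) : Prop :=
  forall x0 xf : 'cV[K]_n, exists (k : nat) (v : nat -> 'cV[K]_p),
    state_seq (linear_step A B) x0 v k = xf.

Definition bilinear_step (n m : nat) (A : 'M[K]_n) (B : 'M[K]_(n, m))
    (N : 'M[K]_(n, n * m)) (x : 'cV[K]_n) (u : 'cV[K]_m) : 'cV[K]_n :=
  A *m x + B *m u + N *m (x *t u).

Definition tens_seq (n m : nat) (x : nat -> 'cV[K]_n) (u : nat -> 'cV[K]_m)
    (t : nat) : 'cV[K]_(n * m) :=
  x t *t u t.

Definition data_matrix (n m : nat) (x : nat -> 'cV[K]_n) (u : nat -> 'cV[K]_m)
    (T L : nat) :=
  let q := (L - T).+1 in
  col_mx (hankel x 0 1 q)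
    (col_mx (hankel u 0 T q) (hankel (tens_seq x u) 0 T q)).

Definition persistently_exciting (n m : nat) (x : nat -> 'cV[K]_n)
    (u : nat -> 'cV[K]_m) (T L : nat) : Prop :=
  row_free (data_matrix x u T L).

End Systems.

Section Optimization.
Context {K : realType}.

Definition optimal_value (Z : Type) (feasible : Z -> Prop) (J : Z -> K) :
    \bar K :=
  ereal_inf [set (J z)%:E | z in [set z | feasible z]].

Definition minimizer (Z : Type) (feasible : Z -> Prop) (J : Z -> K) (z : Z) :
    Prop :=
  feasible z /\ forall z', feasible z' -> J z <= J z'.

End Optimization.

Section OptimalControl.
Context {K : realType}.

Definition quad (n : nat) (Q : 'M[K]_n) (x : 'cV[K]_n) : K :=
  (x^T *m Q *m x) 0 0.

Definition psd (n : nat) (Q : 'M[K]_n) : Prop :=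
  Q^T = Q /\ forall x : 'cV[K]_n, 0 <= quad Q x.

Definition cost (n m : nat) (Q : 'M[K]_n) (R : 'M[K]_m) (T : nat)
    (X : 'cV[K]_(\sum_(s < T.+1) n)) (U : 'cV[K]_(\sum_(s < T) m)) : K :=
  \sum_(t < T) (quad Q (block X t) + quad R (block U t)).

(* Model-based problem over stacked inputs U: the dynamics and x(0) = x0
   determine the state trajectory (see state_seqP), so that only the terminal
   condition is left as a constraint on U. *)
Definition trajectory (n m : nat) (A : 'M[K]_n) (B : 'M[K]_(n, m))
    (N : 'M[K]_(n, n * m)) (x0 : 'cV[K]_n) (T : nat)
    (U : 'cV[K]_(\sum_(s < T) m)) : 'cV[K]_(\sum_(s < T.+1) n) :=
  stack (state_seq (bilinear_step A B N) x0 (block U)) 0 T.+1.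

Definition feasible1 (n m : nat) (A : 'M[K]_n) (B : 'M[K]_(n, m))
    (N : 'M[K]_(n, n * m)) (x0 xf : 'cV[K]_n) (T : nat)
    (U : 'cV[K]_(\sum_(s < T) m)) : Prop :=
  block (trajectory A B N x0 U) T = xf.

Definition cost1 (n m : nat) (A : 'M[K]_n) (B : 'M[K]_(n, m))
    (N : 'M[K]_(n, n * m)) (Q : 'M[K]_n) (R : 'M[K]_m) (x0 : 'cV[K]_n)
    (T : nat) (U : 'cV[K]_(\sum_(s < T) m)) : K :=
  cost Q R (trajectory A B N x0 U) U.

(* Data-based problem over alpha: the stacked vectors xbar and ubar are the
   ones that the Hankel equation determines from alpha. *)
Definition data_states (n : nat) (x : nat -> 'cV[K]_n) (T L : nat)
    (alpha : 'cV[K]_((L - T).+1)) : 'cV[K]_(\sum_(s < T.+1) n) :=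
  hankel x 0 T.+1 (L - T).+1 *m alpha.

Definition data_inputs (m : nat) (u : nat -> 'cV[K]_m) (T L : nat)
    (alpha : 'cV[K]_((L - T).+1)) : 'cV[K]_(\sum_(s < T) m) :=
  hankel u 0 T (L - T).+1 *m alpha.

Definition feasible2 (n m : nat) (x : nat -> 'cV[K]_n) (u : nat -> 'cV[K]_m)
    (x0 xf : 'cV[K]_n) (T L : nat) (alpha : 'cV[K]_((L - T).+1)) : Prop :=
  let X := data_states x alpha in
  let U := data_inputs u alpha in
  [/\ block X 0 = x0, block X T = xf &
      stack (tens_seq (block X) (block U)) 0 T =
        hankel (tens_seq x u) 0 T (L - T).+1 *m alpha].

Definition cost2 (n m : nat) (Q : 'M[K]_n) (R : 'M[K]_m)
    (x : nat -> 'cV[K]_n) (u : nat -> 'cV[K]_m) (T L : nat)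
    (alpha : 'cV[K]_((L - T).+1)) : K :=
  cost Q R (data_states x alpha) (data_inputs u alpha).

End OptimalControl.

(* Main.v *)
(* The data satisfy x(t+1) = A x(t) + B u(t) + N (x(t) ⊗ u(t)), which is linear
   in the triple (x, u, x ⊗ u).  Hence the combination with weights alpha of the
   length-T windows of the data is a trajectory as soon as its third component
   is the Kronecker product of the first two.  Conversely, full row rank of the
   data matrix lets alpha match any initial state, input sequence and Kronecker
   sequence; for those of a given trajectory, the states agree by induction
   on time. *)
Require Import Defs.
From mathcomp Require Import all_boot all_order all_algebra.
From mathcomp Require Import classical_sets.
From mathcomp Require Import reals constructive_ereal ereal.

Import Order.TTheory GRing.Theory Num.Theory.

Local Open Scope ring_scope.

Section StackedVectors.
Context {K : realType} {d : nat}.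
Implicit Types (f : nat -> 'cV[K]_d) (i k q t : nat).

Lemma blockE k (X : 'cV[K]_(\sum_(s < k) d)) (s : 'I_k) :
  block X s = submxcol X s.
Proof. by rewrite /block valK. Qed.

Lemma eq_block k (X Y : 'cV[K]_(\sum_(s < k) d)) :
  (forall t, (t < k)%N -> block X t = block Y t) -> X = Y.
Proof.
by move=> XY; apply/mxcolP => s; rewrite -!blockE; apply: XY.
Qed.

Lemma stack_block k (X : 'cV[K]_(\sum_(s < k) d)) : stack (block X) 0 k = X.
Proof. by apply: eq_block => t tk; rewrite blockK. Qed.

(** The depth of the Hankel matrix does not enter: products of depths [1], [T] and [T.+1] with the
    same [alpha] are initial pieces of one sequence, so they can be compared time by time. *)
Definition window_comb q f (alpha : 'cV[K]_q) t : 'cV[K]_d :=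
  \sum_(c < q) alpha c 0 *: f (c + t)%N.

Lemma hankel_mul k q f (alpha : 'cV[K]_q) :
  hankel f 0 k q *m alpha = stack (window_comb q f alpha) 0 k.
Proof.
apply/colP => r; rewrite !mxE summxE; apply: eq_bigr => c _.
by rewrite !mxE mulrC !add0n.
Qed.

Lemma block_hankel_mul k q f (alpha : 'cV[K]_q) t : (t < k)%N ->
  block (hankel f 0 k q *m alpha) t = window_comb q f alpha t.
Proof. by move=> tk; rewrite hankel_mul blockK. Qed.

End StackedVectors.

(** The last term combines the Kronecker products of the data; in general it differs from the
    Kronecker product of the combined state and input, so this is not yet a [bilinear_step]. *)
Lemma window_comb_bilinear {K : realType} {n m : nat}
    (A : 'M[K]_n) (B : 'M[K]_(n, m)) (N : 'M[K]_(n, n * m)) (T L : nat)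
    (x : nat -> 'cV[K]_n) (u : nat -> 'cV[K]_m) :
  (T <= L)%N ->
  (forall t, (t < L)%N -> x t.+1 = bilinear_step A B N (x t) (u t)) ->
  forall (alpha : 'cV[K]_(L - T).+1) t, (t < T)%N ->
  window_comb _ x alpha t.+1 =
    A *m window_comb _ x alpha t + B *m window_comb _ u alpha t +
    N *m window_comb _ (tens_seq x u) alpha t.
Proof.
move=> TL xS alpha t tT; rewrite /window_comb !mulmx_sumr -!big_split /=.
apply: eq_bigr => c _; have cL : (c <= L - T)%N by rewrite -ltnS.
(* The dynamics hold at time [c + t] because [c <= L - T] and [t < T] give [c + t < L]. *)
rewrite addnS xS; last first.
  by rewrite -addnS (leq_trans (leq_add cL tT)) // subnK.
by rewrite -!scalemxAr -!scalerDr.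
Qed.

Lemma data_states_trajectory {K : realType} {n m : nat}
    (A : 'M[K]_n) (B : 'M[K]_(n, m)) (N : 'M[K]_(n, n * m)) (T L : nat)
    (x : nat -> 'cV[K]_n) (u : nat -> 'cV[K]_m) (x0 xf : 'cV[K]_n)
    (alpha : 'cV[K]_(L - T).+1) :
  (T <= L)%N ->
  (forall t, (t < L)%N -> x t.+1 = bilinear_step A B N (x t) (u t)) ->
  feasible2 x u x0 xf alpha ->
  trajectory A B N x0 (data_inputs u alpha) = data_states x alpha.
Proof.
move=> TL xS [X0 _ XU].
rewrite -[RHS]stack_block; apply: eq_block => t tT; rewrite !blockK //.
(* By uniqueness of the state sequence, only the initial value and the one-step recursion remain to
   be checked. *)
apply/esym; move: t tT; apply/state_seqP; split=> // t tT.
have tU : block (data_inputs u alpha) t = window_comb _ u alpha t.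
  exact: block_hankel_mul.
have tX : block (data_states x alpha) t = window_comb _ x alpha t.
  by apply: block_hankel_mul; apply: ltnW.
(* Block [t] of the Kronecker constraint turns the linear recursion of the combined data into a
   genuine bilinear step. *)
have := congr1 (fun Z => block Z t) XU.
rewrite blockK // block_hankel_mul // /tens_seq add0n => tXU.
rewrite [LHS]block_hankel_mul // (window_comb_bilinear A B N T L x u TL xS) //.
by rewrite /bilinear_step tXU tU tX.
Qed.

(** A matrix of full row rank has a right inverse, here [pinvmx]. *)
Lemma persistently_exciting_onto {K : realType} {n m : nat} (T L : nat)
    (x : nat -> 'cV[K]_n) (u : nat -> 'cV[K]_m) :
  persistently_exciting x u T L ->
  forall X U V, exists alpha : 'cV[K]_(L - T).+1,
    [/\ hankel x 0 1 (L - T).+1 *m alpha = X,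
        hankel u 0 T (L - T).+1 *m alpha = U &
        hankel (tens_seq x u) 0 T (L - T).+1 *m alpha = V].
Proof.
move=> pe X U V; exists (pinvmx (data_matrix x u T L) *m col_mx X (col_mx U V)).
set alpha := pinvmx _ *m _.
have : data_matrix x u T L *m alpha = col_mx X (col_mx U V).
  by rewrite mulmxA mulmxVp // mul1mx.
by rewrite /data_matrix !mul_col_mx => /eq_col_mx[-> /eq_col_mx[-> ->]].
Qed.

Lemma trajectory_data_states {K : realType} {n m : nat}
    (A : 'M[K]_n) (B : 'M[K]_(n, m)) (N : 'M[K]_(n, n * m)) (T L : nat)
    (x : nat -> 'cV[K]_n) (u : nat -> 'cV[K]_m) (x0 xf : 'cV[K]_n)
    (U : 'cV[K]_(\sum_(s < T) m)) :
  (T <= L)%N ->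
  (forall t, (t < L)%N -> x t.+1 = bilinear_step A B N (x t) (u t)) ->
  persistently_exciting x u T L ->
  feasible1 A B N x0 xf U ->
  exists alpha : 'cV[K]_(L - T).+1,
    [/\ feasible2 x u x0 xf alpha, data_inputs u alpha = U &
        data_states x alpha = trajectory A B N x0 U].
Proof.
move=> TL xS pe UF; pose z := state_seq (bilinear_step A B N) x0 (block U).
(* Only the first state of [z] can be prescribed, since the state block of the data matrix has depth
   1; the later states are forced by the recursion. *)
have [alpha [aX aU aXU]] := persistently_exciting_onto T L x u pe
  (stack z 0 1) U (stack (tens_seq z (block U)) 0 T).
have xz t : (t <= T)%N -> window_comb _ x alpha t = z t.
  elim: t => [|t IHt] tT.
    by rewrite -(@block_hankel_mul _ _ 1) // aX blockK.
  rewrite (window_comb_bilinear A B N T L x u TL xS) // IHt ?(ltnW tT) //.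
  rewrite -[window_comb _ u _ _](@block_hankel_mul _ _ T) // aU.
  by rewrite -(@block_hankel_mul _ _ T) // aXU blockK.
have XE : data_states x alpha = trajectory A B N x0 U.
  apply: eq_block => t tT.
  by rewrite block_hankel_mul // xz // /trajectory blockK.
exists alpha; split=> //; split; rewrite XE //; first by rewrite blockK.
(* Both sides are now built from [z] and [U]: the combined states have been identified with the
   trajectory. *)
rewrite aXU /data_inputs aU; apply: eq_block => t tT.
by rewrite !blockK // /tens_seq blockK // ltnW.
Qed.

Section CostPreservingMap.
Context {K : realType} {Z1 Z2 : Type} (F1 : Z1 -> Prop) (F2 : Z2 -> Prop).
Context (J1 : Z1 -> K) (J2 : Z2 -> K) (h : Z2 -> Z1).
Context (h_feasible : forall z, F2 z -> F1 (h z)).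
Context (h_cost : forall z, F2 z -> J1 (h z) = J2 z).
Context (h_onto : forall y, F1 y -> exists2 z, F2 z & h z = y).

(** Both problems attain the same set of costs, which may be empty. *)
Lemma optimal_value_onto : optimal_value F1 J1 = optimal_value F2 J2.
Proof.
congr ereal_inf; apply/seteqP; split=> _ [y Fy <-].
  by have [z Fz <-] := h_onto y Fy; exists z; rewrite ?h_cost.
by exists (h y); [apply: h_feasible | rewrite h_cost].
Qed.

(** Every competitor of [h z] is some [h w] with [w] feasible, so the comparisons on the two sides
    correspond, even if [h] is not injective. *)
Lemma minimizer_onto z : minimizer F2 J2 z <-> F2 z /\ minimizer F1 J1 (h z).
Proof.
split=> [[Fz minz]|[Fz [_ minz]]]; split=> //.
  split=> [|y /h_onto[w Fw <-]]; first exact: h_feasible.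
  by rewrite !h_cost //; apply: minz.
by move=> w Fw; rewrite -!h_cost //; apply/minz/h_feasible.
Qed.

End CostPreservingMap.

Theorem mainTheorem3 (K : realType) (n m : nat)
  (A : 'M[K]_n) (B : 'M[K]_(n, m)) (N : 'M[K]_(n, n * m))
  (hAB : controllable A (row_mx B N))
  (T L : nat) (hT : (1 <= T)%N) (hTL : (T <= L)%N)
  (Q : 'M[K]_n) (R : 'M[K]_m) (hQ : psd Q) (hR : psd R)
  (x0 xf : 'cV[K]_n)
  (x : nat -> 'cV[K]_n) (u : nat -> 'cV[K]_m)
  (hdata : forall t : nat, (t < L)%N ->
     x t.+1 = A *m x t + B *m u t + N *m (x t *t u t))
  (hpe : persistently_exciting x u T L) :
  let F1 := @feasible1 K n m A B N x0 xf T in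
  let J1 := @cost1 K n m A B N Q R x0 T in
  let F2 := @feasible2 K n m x u x0 xf T L in
  let J2 := @cost2 K n m Q R x u T L in
  [/\ (forall alpha : 'cV[K]_((L - T).+1), F2 alpha ->
         [/\ F1 (data_inputs u alpha),
             trajectory A B N x0 (data_inputs u alpha) = data_states x alpha &
             J1 (data_inputs u alpha) = J2 alpha]),
      (forall U : 'cV[K]_(\sum_(s < T) m), F1 U ->
         exists alpha : 'cV[K]_((L - T).+1),
           [/\ F2 alpha, data_inputs u alpha = U &
               data_states x alpha = trajectory A B N x0 U]),
      optimal_value F1 J1 = optimal_value F2 J2 &
      (forall alpha : 'cV[K]_((L - T).+1),
         minimizer F2 J2 alpha <->
         F2 alpha /\ minimizer F1 J1 (data_inputs u alpha))].
Proof.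
move=> F1 J1 F2 J2.
have sound alpha : F2 alpha -> [/\ F1 (data_inputs u alpha),
    trajectory A B N x0 (data_inputs u alpha) = data_states x alpha &
    J1 (data_inputs u alpha) = J2 alpha].
  move=> Fa; have tr := data_states_trajectory A B N T L x u _ _ _ hTL hdata Fa.
  (* Once the trajectories agree, the two costs are the same expression, and the terminal condition
     is the one contained in [F2]. *)
  rewrite /F1 /J1 /feasible1 /cost1 tr; split=> //.
  by case: Fa.
have onto U : F1 U -> exists alpha : 'cV[K]_((L - T).+1),
    [/\ F2 alpha, data_inputs u alpha = U &
        data_states x alpha = trajectory A B N x0 U].
  exact: trajectory_data_states.
have h_feasible alpha : F2 alpha -> F1 (data_inputs u alpha).
  by case/sound.
have h_cost alpha : F2 alpha -> J1 (data_inputs u alpha) = J2 alpha.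
  by case/sound.
have h_onto U : F1 U -> exists2 alpha, F2 alpha & data_inputs u alpha = U.
  by case/onto=> alpha [Fa aU _]; exists alpha.
split=> //; first exact: (optimal_value_onto F1 F2 J1 J2 _ h_feasible h_cost h_onto).
exact: (minimizer_onto F1 F2 J1 J2 _ h_feasible h_cost h_onto).
Qed.
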